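(* (1) $F$-birestriction monoids in the signature $(\cdot,{}^*,{}^+,{}^{\mathfrak m},1)$ form a variety $\mathbf{FBR}$ of type $(2,1,1,1,0)$. It is defined by all the identities which define the variety of birestriction monoids, along with the identities $$x^{\mathfrak m}x^*=x,\qquad (xy^* )^{\mathfrak m}=x^{\mathfrak m}.$$ (2) Left strong and right strong $F$-birestriction monoids form the subvarieties $\mathbf{FBR_{ls}}$ and $\mathbf{FBR_{rs}}$ of $\mathbf{FBR}$, defined by the identities which define $\mathbf{FBR}$ along with the identities $$x^{\mathfrak m}y^{\mathfrak m}=(x^{\mathfrak m})^+(xy)^{\mathfrak m}\qquad\text{and}\qquad x^{\mathfrak m}y^{\mathfrak m}=(xy)^{\mathfrak m}(y^{\mathfrak m})^*,$$ respectively. (3) Strong $F$-birestriction monoids form the subvariety $\mathbf{FBR_s}=\mathbf{FBR_{ls}}\cap\mathbf{FBR_{rs}}$ of $\mathbf{FBR}$. (4) Perfect $F$-birestriction monoids form the subvariety $\mathbf{FBR_p}$ of $\mathbf{FBR}$, defined by the identities which define $\mathbf{FBR}$ along with the identity $$x^{\mathfrak m}y^{\mathfrak m}=(xy)^{\mathfrak m}.$$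
   Context: A birestriction monoid is an algebra $(S;\cdot,{}^*,{}^+,1)$ such that $(S;\cdot,1)$ is a monoid and for all $x,y$: $xx^*=x$, $x^*y^*=y^*x^*$, $(xy^* )^*=x^*y^*$, $x^*y=y(xy)^*$; $x^+x=x$, $x^+y^+=y^+x^+$, $(x^+y)^+=x^+y^+$, $xy^+=(xy)^+x$; $(x^+)^*=x^+$, $(x^* )^+=x^*$. Its projections are $P(S)=\{s^*:s\in S\}=\{s^+:s\in S\}$. The natural partial order is: $s\le t$ iff $s=et$ for some $e\in P(S)$ (equivalently, $s=ts^*$). The relation $\sigma$ is the minimum congruence identifying all projections: $s\mathrel{\sigma}t$ iff $se=te$ for some $e\in P(S)$. An $F$-birestriction monoid is a birestriction monoid in which every $\sigma$-class has a maximum element with respect to $\le$; $s^{\mathfrak m}$ denotes the maximum element of the $\sigma$-class of $s$. Let $\tau\colon S/\sigma\to S$ be the map sending the $\sigma$-class of $s$ to $s^{\mathfrak m}$. $S$ is left strong if $\tau(m)\tau(n)=\tau(m)^+\tau(mn)$ for all $m,n\in S/\sigma$; right strong if $\tau(m)\tau(n)=\tau(mn)\tau(n)^*$ for all $m,n\in S/\sigma$; strong if it is both left and right strong; perfect if $\tau$ is a monoid morphism. *)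

(* Defs.v *)
From Stdlib Require Import List RelationClasses ClassicalEpsilon.
Import ListNotations.
Set Implicit Arguments.
Unset Strict Implicit.

Declare Scope alg_scope.
Delimit Scope alg_scope with alg.
Declare Scope term_scope.
Delimit Scope term_scope with term.
Reserved Notation "x ^*" (at level 1, left associativity, format "x ^*").
Reserved Notation "x ^+" (at level 1, left associativity, format "x ^+").
Reserved Notation "x ^m" (at level 1, left associativity, format "x ^m").

(* Algebras of type (2,1,1,0); no axioms are imposed. *)
Record balg : Type := Balg {
  carrier :> Type;
  mul : carrier -> carrier -> carrier;
  star : carrier -> carrier;
  plus : carrier -> carrier;
  one : carrier
}.
Arguments one {b}.

Notation "x * y" := (mul x y) : alg_scope.
Notation "x ^*" := (star x) : alg_scope.
Notation "x ^+" := (plus x) : alg_scope.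
Notation "1" := one : alg_scope.
Local Open Scope alg_scope.

Record birestriction_monoid (S : balg) : Prop := BirestrictionMonoid {
  br_mulA : forall x y z : S, (x * y) * z = x * (y * z);
  br_mulx1 : forall x : S, x * 1 = x;
  br_mul1x : forall x : S, 1 * x = x;
  br_mul_star : forall x : S, x * x^* = x;
  br_starC : forall x y : S, x^* * y^* = y^* * x^*;
  br_star_mul_star : forall x y : S, (x * y^*)^* = x^* * y^*;
  br_star_ample : forall x y : S, x^* * y = y * (x * y)^*;
  br_plus_mul : forall x : S, x^+ * x = x;
  br_plusC : forall x y : S, x^+ * y^+ = y^+ * x^+;
  br_plus_mul_plus : forall x y : S, (x^+ * y)^+ = x^+ * y^+;
  br_plus_ample : forall x y : S, x * y^+ = (x * y)^+ * x;
  br_plus_star : forall x : S, (x^+)^* = x^+;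
  br_star_plus : forall x : S, (x^*)^+ = x^*
}.

Definition projection (S : balg) (e : S) : Prop := exists s : S, e = s^*.

Definition nat_le (S : balg) (s t : S) : Prop :=
  exists e : S, projection e /\ s = e * t.

Record congruence (S : balg) (R : S -> S -> Prop) : Prop := Congruence {
  cong_equiv : Equivalence R;
  cong_mul : forall s s' t t' : S, R s s' -> R t t' -> R (s * t) (s' * t');
  cong_star : forall s s' : S, R s s' -> R (s^*) (s'^*);
  cong_plus : forall s s' : S, R s s' -> R (s^+) (s'^+)
}.

(* The minimum congruence identifying all projections, as the intersection of
   all such congruences. *)
Definition sigma (S : balg) (s t : S) : Prop :=
  forall R : S -> S -> Prop, congruence R ->
    (forall e f : S, projection e -> projection f -> R e f) -> R s t.

Lemma sigma_refl (S : balg) (s : S) : sigma s s.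
Proof. intros R HR _. apply (cong_equiv HR). Qed.

Lemma sigma_trans (S : balg) (s t u : S) : sigma s t -> sigma t u -> sigma s u.
Proof.
  intros Hst Htu R HR HP. destruct (cong_equiv HR) as [_ _ HT].
  exact (HT _ _ _ (Hst R HR HP) (Htu R HR HP)).
Qed.

Lemma sigma_mul (S : balg) (s s' t t' : S) :
  sigma s s' -> sigma t t' -> sigma (s * t) (s' * t').
Proof.
  intros Hs Ht R HR HP. exact (cong_mul HR (Hs R HR HP) (Ht R HR HP)).
Qed.

(* Elements of [S/sigma] are the sigma-classes, as subsets of [S]. *)
Definition sigma_quot (S : balg) : Type :=
  { C : S -> Prop | exists s : S, forall t : S, C t <-> sigma s t }.

Definition in_class (S : balg) (C : sigma_quot S) (s : S) : Prop :=
  proj1_sig C s.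

Definition class_of (S : balg) (s : S) : sigma_quot S :=
  exist _ (fun t => sigma s t)
    (ex_intro _ s (fun t => conj (fun H => H) (fun H => H))).

Lemma quot_mul_class (S : balg) (C D : sigma_quot S) :
  exists s : S, forall u : S,
    (exists x y : S, in_class C x /\ in_class D y /\ sigma (x * y) u)
    <-> sigma s u.
Proof.
  destruct C as [C [s HC]], D as [D [t HD]]. unfold in_class; simpl.
  exists (s * t). intro u. split.
  - intros (x & y & Hx & Hy & Hu).
    apply sigma_trans with (2 := Hu).
    apply sigma_mul; [apply HC, Hx | apply HD, Hy].
  - intro Hu. exists s, t.
    split; [apply HC, sigma_refl | split; [apply HD, sigma_refl | exact Hu]].
Qed.

Definition quot_mul (S : balg) (C D : sigma_quot S) : sigma_quot S :=
  exist _ (fun u => exists x y : S,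
             in_class C x /\ in_class D y /\ sigma (x * y) u)
    (quot_mul_class C D).

Definition quot_one (S : balg) : sigma_quot S := class_of (@one S).

Definition is_maximum (S : balg) (C : sigma_quot S) (t : S) : Prop :=
  in_class C t /\ forall s : S, in_class C s -> nat_le s t.

Definition F_birestriction_monoid (S : balg) : Prop :=
  birestriction_monoid S /\
  forall C : sigma_quot S, exists t : S, is_maximum C t.

(* The value is arbitrary on classes without maximum; in a birestriction monoid
   [nat_le] is antisymmetric, so a maximum is unique when it exists. *)
Definition tau (S : balg) (C : sigma_quot S) : S :=
  epsilon (inhabits 1) (fun t => is_maximum C t).

(* Since they mention [tau], the next four notions are meaningful for
   F-birestriction monoids only. *)
Definition left_strong (S : balg) : Prop :=
  forall m n : sigma_quot S,
    tau m * tau n = (tau m)^+ * tau (quot_mul m n).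

Definition right_strong (S : balg) : Prop :=
  forall m n : sigma_quot S,
    tau m * tau n = tau (quot_mul m n) * (tau n)^*.

Definition strong (S : balg) : Prop := left_strong S /\ right_strong S.

Definition perfect (S : balg) : Prop :=
  (forall m n : sigma_quot S, tau (quot_mul m n) = tau m * tau n) /\
  tau (quot_one S) = 1.

Record falg : Type := Falg {
  reduct :> balg;
  fm : reduct -> reduct
}.
Notation "x ^m" := (fm x) : alg_scope.

Inductive term : Type :=
| Var (i : nat)
| Tmul (t u : term)
| Tstar (t : term)
| Tplus (t : term)
| Tm (t : term)
| Tone.

Fixpoint eval (A : falg) (v : nat -> A) (t : term) : A :=
  match t with
  | Var i => v i
  | Tmul t u => eval v t * eval v u
  | Tstar t => (eval v t)^*
  | Tplus t => (eval v t)^+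
  | Tm t => (eval v t)^m
  | Tone => 1
  end.

Definition identity : Type := (term * term)%type.

Definition satisfies (A : falg) (p : identity) : Prop :=
  forall v : nat -> A, eval v (fst p) = eval v (snd p).

Definition defined_by (K : falg -> Prop) (E : list identity) : Prop :=
  forall A : falg, K A <-> (forall p, In p E -> satisfies A p).

Record homomorphism (A B : falg) (f : A -> B) : Prop := Homomorphism {
  hom_mul : forall x y : A, f (x * y) = f x * f y;
  hom_star : forall x : A, f (x^*) = (f x)^*;
  hom_plus : forall x : A, f (x^+) = (f x)^+;
  hom_m : forall x : A, f (x^m) = (f x)^m;
  hom_one : f 1 = 1
}.

Definition product (I : Type) (A : I -> falg) : falg :=
  @Falg (@Balg (forall i, A i)
           (fun x y i => x i * y i) (fun x i => (x i)^*)
           (fun x i => (x i)^+) (fun i => 1))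
    (fun x i => (x i)^m).

(* Closure under homomorphic images, subalgebras (up to isomorphism) and
   arbitrary products. *)
Record is_variety (K : falg -> Prop) : Prop := IsVariety {
  variety_H : forall (A B : falg) (f : A -> B), homomorphism f ->
    (forall b : B, exists a : A, f a = b) -> K A -> K B;
  variety_S : forall (A B : falg) (f : B -> A), homomorphism f ->
    (forall x y : B, f x = f y -> x = y) -> K A -> K B;
  variety_P : forall (I : Type) (A : I -> falg),
    (forall i, K (A i)) -> K (product A)
}.

Definition is_subvariety (V W : falg -> Prop) : Prop :=
  is_variety V /\ is_variety W /\ forall A : falg, V A -> W A.

Definition FBR (A : falg) : Prop :=
  F_birestriction_monoid A /\ forall s : A, is_maximum (class_of s) (s^m).

Definition FBR_ls (A : falg) : Prop := FBR A /\ left_strong A.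
Definition FBR_rs (A : falg) : Prop := FBR A /\ right_strong A.
Definition FBR_s (A : falg) : Prop := FBR A /\ strong A.
Definition FBR_p (A : falg) : Prop := FBR A /\ perfect A.

Notation "t * u" := (Tmul t u) : term_scope.
Notation "t ^*" := (Tstar t) : term_scope.
Notation "t ^+" := (Tplus t) : term_scope.
Notation "t ^m" := (Tm t) : term_scope.
Notation "1" := Tone : term_scope.
Notation "t == u" := (@pair term term t%term u%term)
  (at level 70, no associativity) : term_scope.
Local Open Scope term_scope.

Definition birestriction_identities : list identity :=
  let x := Var 0 in let y := Var 1 in let z := Var 2 in
  [ (x * y) * z == x * (y * z);
    x * 1 == x;
    1 * x == x;
    x * x^* == x;
    x^* * y^* == y^* * x^*;
    (x * y^*)^* == x^* * y^*;
    x^* * y == y * (x * y)^*;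
    x^+ * x == x;
    x^+ * y^+ == y^+ * x^+;
    (x^+ * y)^+ == x^+ * y^+;
    x * y^+ == (x * y)^+ * x;
    (x^+)^* == x^+;
    (x^*)^+ == x^* ].

Definition FBR_identities : list identity :=
  let x := Var 0 in let y := Var 1 in
  birestriction_identities ++
  [ x^m * x^* == x;
    (x * y^*)^m == x^m ].

Definition ls_identity : identity :=
  let x := Var 0 in let y := Var 1 in
  x^m * y^m == (x^m)^+ * (x * y)^m.

Definition rs_identity : identity :=
  let x := Var 0 in let y := Var 1 in
  x^m * y^m == (x * y)^m * (y^m)^*.

Definition perfect_identity : identity :=
  let x := Var 0 in let y := Var 1 in
  x^m * y^m == (x * y)^m.

(* Main.v *)
(** In a birestriction monoid, [s] and [t] are [sigma]-related exactly when
    [s * e = t * e] for some projection [e].  Hence [(x y^* )^m = x^m] says that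
    [x |-> x^m] is constant on [sigma]-classes, and [x^m x^* = x] says that [x^m]
    lies in the class of [x] and above [x]; together they say that [x^m] is the
    maximum of that class.  The map [tau] then sends the class of [x] to [x^m],
    so (left, right) strength and perfection turn into identities ([1^m = 1] holds
    in every F-birestriction monoid, because [1^m = 1^m 1^* = 1]).  Finally, a
    class defined by identities is closed under H, S and P. *)

Require Import Defs.
From Stdlib Require Import List.
Import ListNotations.
From Stdlib Require Import ClassicalEpsilon FunctionalExtensionality.

Local Open Scope alg_scope.

(** * Classes defined by identities *)

Lemma eval_hom (A B : falg) (f : A -> B) (Hf : homomorphism f)
    (v : nat -> A) (t : term) :
  f (eval v t) = eval (fun i => f (v i)) t.
Proof.
  induction t; simpl.
  - reflexivity.
  - rewrite (hom_mul Hf); congruence.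
  - rewrite (hom_star Hf); congruence.
  - rewrite (hom_plus Hf); congruence.
  - rewrite (hom_m Hf); congruence.
  - apply (hom_one Hf).
Qed.

Lemma eval_ext (A : falg) (v w : nat -> A) (t : term) :
  (forall i, v i = w i) -> eval v t = eval w t.
Proof. intro H; induction t; simpl; congruence. Qed.

Lemma product_proj_hom (I : Type) (A : I -> falg) (i : I) :
  homomorphism (A := product A) (B := A i) (fun x => x i).
Proof. split; reflexivity. Qed.

(** The easy half of Birkhoff's theorem: homomorphisms commute with term evaluation, so an identity
    is lifted along a surjection, cancelled along an injection, and checked coordinatewise in a
    product. *)
Lemma defined_by_variety (K : falg -> Prop) (E : list identity) :
  defined_by K E -> is_variety K.
Proof.
  intro HK; split.
  - intros A B f Hf Hsurj HA; apply HK; intros p Hp w.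
    (* Choosing a preimage of each [w i] lifts the valuation to [A]. *)
    set (v i := proj1_sig (constructive_indefinite_description _ (Hsurj (w i)))).
    assert (Hv : forall i, f (v i) = w i)
      by (intro i; unfold v; apply proj2_sig).
    rewrite <- (eval_ext _ _ _ (fst p) Hv), <- (eval_ext _ _ _ (snd p) Hv).
    rewrite <- !(eval_hom A B f Hf).
    f_equal; exact (proj1 (HK A) HA p Hp v).
  - intros A B f Hf Hinj HA; apply HK; intros p Hp v.
    apply Hinj; rewrite !(eval_hom B A f Hf).
    exact (proj1 (HK A) HA p Hp _).
  - intros I A HA; apply HK; intros p Hp v.
    apply functional_extensionality_dep; intro i.
    rewrite !(eval_hom (product A) (A i) _ (product_proj_hom I A i)).
    exact (proj1 (HK (A i)) (HA i) p Hp _).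
Qed.

Lemma defined_by_extend (K V : falg -> Prop) (E E' : list identity) :
  defined_by K E ->
  (forall A, V A <-> K A /\ Forall (satisfies A) E') ->
  defined_by V (E ++ E').
Proof.
  intros HK HV A; rewrite HV, (HK A), <- !Forall_forall, Forall_app; reflexivity.
Qed.

Lemma defined_by_subvariety (K V : falg -> Prop) (E E' : list identity) :
  defined_by K E -> defined_by V (E ++ E') -> is_subvariety V K.
Proof.
  intros HK HV; split; [|split].
  - exact (defined_by_variety _ _ HV).
  - exact (defined_by_variety _ _ HK).
  - intros A HA; apply HK; intros p Hp.
    apply (proj1 (HV A) HA); apply in_or_app; left; exact Hp.
Qed.

(** Three variables suffice for every identity above; those with fewer repeat an argument as
    filler. *)
Definition valuation {T : Type} (x y z : T) (i : nat) : T :=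
  match i with 0 => x | S O => y | _ => z end.

(** * The classes of sigma *)

Lemma sigma_sym (S : balg) (s t : S) : sigma s t -> sigma t s.
Proof.
  intros H R HR HP; destruct (cong_equiv HR) as [_ Hsym _].
  apply Hsym, H; assumption.
Qed.

Lemma in_classE (S : balg) (C : sigma_quot S) (s : S) :
  in_class C s -> forall t, in_class C t <-> sigma s t.
Proof.
  destruct C as [C [r HC]]; unfold in_class; simpl.
  intros Hs t; rewrite HC; apply HC in Hs; split; intro H.
  - apply sigma_trans with r; [apply sigma_sym|]; assumption.
  - apply sigma_trans with s; assumption.
Qed.

(** Any member can serve as representative, and membership equivalence is enough: no equality
    between classes is needed. *)
Lemma is_maximum_class (S : balg) (C : sigma_quot S) (s t : S) :
  in_class C s -> (is_maximum C t <-> is_maximum (class_of s) t).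
Proof.
  intro Hs; unfold is_maximum; rewrite (in_classE S C s Hs t).
  split; intros [Ht Hmax]; (split; [exact Ht|]).
  - intros u Hu; apply Hmax, (in_classE S C s Hs), Hu.
  - intros u Hu; apply Hmax, (in_classE S C s Hs), Hu.
Qed.

Lemma class_inhabited (S : balg) (C : sigma_quot S) : exists s, in_class C s.
Proof.
  destruct C as [C [s HC]]; exists s; apply HC, sigma_refl.
Qed.

Lemma in_quot_mul (S : balg) (C D : sigma_quot S) (s t : S) :
  in_class C s -> in_class D t -> in_class (quot_mul C D) (s * t).
Proof. intros Hs Ht; exists s, t; auto using sigma_refl. Qed.

(** * Birestriction monoids *)

Section Birestriction.
Variable S : balg.
Hypothesis HS : birestriction_monoid S.

Lemma star1 : (1 : S)^* = 1.
Proof. rewrite <- (br_mul1x HS (1^*)); apply (br_mul_star HS). Qed.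

Lemma star_star (x : S) : x^*^* = x^*.
Proof.
  rewrite <- (br_mul1x HS (x^*)) at 1.
  now rewrite (br_star_mul_star HS), star1, (br_mul1x HS).
Qed.

Lemma projection_star (e : S) : projection e -> e^* = e.
Proof. intros [s ->]; apply star_star. Qed.

Lemma projection_plus (e : S) : projection e -> e^+ = e.
Proof. intros [s ->]; apply (br_star_plus HS). Qed.

Lemma star_projection (s : S) : projection (s^*).
Proof. exists s; reflexivity. Qed.

Lemma plus_projection (s : S) : projection (s^+).
Proof. exists (s^+); symmetry; apply (br_plus_star HS). Qed.

Lemma one_projection : projection (1 : S).
Proof. exists 1; symmetry; exact star1. Qed.

Lemma projectionC (e f : S) : projection e -> projection f -> e * f = f * e.
Proof. intros [s ->] [t ->]; apply (br_starC HS). Qed.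

Lemma projection_mul (e f : S) :
  projection e -> projection f -> projection (e * f).
Proof.
  intros [s ->] [t ->]; exists (s * t^*); symmetry; apply (br_star_mul_star HS).
Qed.

Lemma projection_idem (e : S) : projection e -> e * e = e.
Proof.
  intro He; rewrite <- (projection_star e He) at 2; apply (br_mul_star HS).
Qed.

Lemma projection_mulC (e t : S) : projection e -> e * t = t * (e * t)^*.
Proof.
  intro He; rewrite <- (projection_star e He) at 1.
  apply (br_star_ample HS).
Qed.

Lemma nat_leE (s t : S) : nat_le s t <-> s = t * s^*.
Proof.
  split.
  - intros [e [He ->]]; now apply projection_mulC.
  (* The witness comes from [t * e^+ = (t * e)^+ * t] at [e = s^*], which is its own plus. *)
  - intro H; exists ((t * s^*)^+); split; [apply plus_projection|].
    rewrite <- (br_plus_ample HS), (projection_plus _ (star_projection s)).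
    exact H.
Qed.

Lemma nat_le_antisym (s t : S) : nat_le s t -> nat_le t s -> s = t.
Proof.
  rewrite !nat_leE; intros Hs Ht.
  (* The chain is [t = s t^* = s s^* t^* = s t^* s^* = t s^* = s]. *)
  rewrite Ht, Hs at 1.
  rewrite <- (br_mul_star HS s) at 2.
  rewrite (br_mulA HS), (br_starC HS), <- (br_mulA HS), <- Ht.
  reflexivity.
Qed.

(** * Explicit description of [sigma] *)

Definition coincide (s t : S) : Prop :=
  exists e : S, projection e /\ s * e = t * e.

(** Both [e] and [f] absorb the projection [e * f]. *)
Lemma coincide_projections (e f : S) :
  projection e -> projection f -> coincide e f.
Proof.
  intros He Hf; exists (e * f); split; [now apply projection_mul|].
  rewrite <- (br_mulA HS), projection_idem by assumption.
  rewrite (projectionC e f) by assumption.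
  now rewrite <- (br_mulA HS), projection_idem.
Qed.

Lemma coincide_mul (s s' t t' : S) :
  coincide s s' -> coincide t t' -> coincide (s * t) (s' * t').
Proof.
  intros [e [He Hs]] [f [Hf Ht]].
  (* [e t' = t' (e t')^*] moves [e] past [t'], where it identifies [s] and [s']. *)
  exists (f * (e * t')^*); split.
  { apply projection_mul; [assumption | apply star_projection]. }
  rewrite (br_mulA HS s t), <- (br_mulA HS t), Ht, (br_mulA HS t').
  rewrite (projectionC f) by (assumption || apply star_projection).
  rewrite (br_mulA HS s' t'), <- (br_mulA HS t'), <- projection_mulC by assumption.
  rewrite <- !(br_mulA HS), Hs; reflexivity.
Qed.

Lemma coincide_congruence : congruence coincide.
Proof.
  split.
  - split.
    + intro s; exists 1; split; [apply one_projection | reflexivity].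
    + intros s t [e [He H]]; exists e; auto.
    (* Since projections commute, [e * f] can be read with either factor first:
       [s e f = t e f = t f e = u f e]. *)
    + intros s t u [e [He H]] [f [Hf H']]; exists (e * f).
      split; [now apply projection_mul|].
      transitivity ((t * e) * f); [now rewrite <- H, (br_mulA HS)|].
      rewrite (br_mulA HS), (projectionC e f), <- !(br_mulA HS) by assumption.
      now rewrite H'.
  - apply coincide_mul.
  - intros s t _; apply coincide_projections; apply star_projection.
  - intros s t _; apply coincide_projections; apply plus_projection.
Qed.

(** As [1] is a projection, [sigma] identifies [e] with [1]. *)
Lemma sigma_mul_projection (s e : S) : projection e -> sigma (s * e) s.
Proof.
  intro He; rewrite <- (br_mulx1 HS s) at 2.
  apply sigma_mul; [apply sigma_refl|].
  intros R _ HP; apply HP; [assumption | apply one_projection].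
Qed.

(** Forwards, [coincide] is one of the congruences whose intersection is [sigma]; backwards, [s] is
    related to [s * e = t * e], and that to [t]. *)
Lemma sigmaE (s t : S) : sigma s t <-> coincide s t.
Proof.
  split.
  - intro H; apply H; [apply coincide_congruence | apply coincide_projections].
  - intros [e [He H]]; apply sigma_trans with (s * e).
    + now apply sigma_sym, sigma_mul_projection.
    + rewrite H; now apply sigma_mul_projection.
Qed.

Lemma is_maximum_unique (C : sigma_quot S) (s t : S) :
  is_maximum C s -> is_maximum C t -> s = t.
Proof. intros [Hs Ms] [Ht Mt]; apply nat_le_antisym; auto. Qed.

(** Once a maximum exists, [epsilon] returns one, and antisymmetry leaves no other choice. *)
Lemma tau_maximum (C : sigma_quot S) (t : S) : is_maximum C t -> tau C = t.
Proof.
  intro Ht; apply (is_maximum_unique C); [|exact Ht].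
  unfold tau; apply epsilon_spec; exists t; exact Ht.
Qed.

End Birestriction.

(** * The identities of F-birestriction monoids *)

Lemma birestriction_identitiesP (A : falg) :
  Forall (satisfies A) birestriction_identities <-> birestriction_monoid A.
Proof.
  unfold birestriction_identities; split.
  - rewrite !Forall_cons_iff.
    intros (H1 & H2 & H3 & H4 & H5 & H6 & H7 & H8 & H9 & H10 & H11 & H12 & H13 & _).
    split.
    + intros x y z; exact (H1 (valuation x y z)).
    + intros x; exact (H2 (valuation x x x)).
    + intros x; exact (H3 (valuation x x x)).
    + intros x; exact (H4 (valuation x x x)).
    + intros x y; exact (H5 (valuation x y y)).
    + intros x y; exact (H6 (valuation x y y)).
    + intros x y; exact (H7 (valuation x y y)).
    + intros x; exact (H8 (valuation x x x)).
    + intros x y; exact (H9 (valuation x y y)).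
    + intros x y; exact (H10 (valuation x y y)).
    + intros x y; exact (H11 (valuation x y y)).
    + intros x; exact (H12 (valuation x x x)).
    + intros x; exact (H13 (valuation x x x)).
  - intros []; repeat apply Forall_cons; try apply Forall_nil;
      intro v; simpl; auto.
Qed.

Lemma FBRP (A : falg) :
  FBR A <->
  birestriction_monoid A /\
  (forall x : A, x^m * x^* = x) /\ (forall x y : A, (x * y^*)^m = x^m).
Proof.
  split.
  - intros [[HS _] Hm]; split; [exact HS | split].
    + intro x; symmetry; apply (nat_leE A HS), Hm, sigma_refl.
    (* [x * y^*] and [x] lie in one class, so their maxima agree. *)
    + intros x y; apply (is_maximum_unique A HS (class_of x)); [|apply Hm].
      apply (is_maximum_class A _ (x * y^*)); [|apply Hm].
      apply sigma_sym, sigma_mul_projection, star_projection; exact HS.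
  - intros (HS & Hmul & Hproj).
    assert (Hm : forall s : A, is_maximum (class_of s) (s^m)).
    { intro s; split.
      (* The projection [s^*] works because [s s^* = s = s^m s^*]. *)
      - apply (sigmaE A HS); exists (s^*); split; [apply star_projection|].
        now rewrite (br_mul_star HS), Hmul.
      - intros t [e [[r ->] H]]%(sigmaE A HS); apply (nat_leE A HS).
        rewrite <- (Hproj s r), H, Hproj; symmetry; apply Hmul. }
    split; [split; [exact HS|] | exact Hm].
    intro C; destruct (class_inhabited A C) as [s Hs]; exists (s^m).
    apply (is_maximum_class A C s _ Hs), Hm.
Qed.

Lemma FBR_defined_by : defined_by FBR FBR_identities.
Proof.
  intro A; rewrite FBRP, <- Forall_forall.
  unfold FBR_identities; rewrite Forall_app, birestriction_identitiesP.
  rewrite !Forall_cons_iff.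
  split; intros [HS H]; (split; [exact HS|]).
  - destruct H as [H1 H2].
    split; [|split; [|apply Forall_nil]]; intro v; simpl; auto.
  - destruct H as (H1 & H2 & _); split.
    + intro x; exact (H1 (valuation x x x)).
    + intros x y; exact (H2 (valuation x y y)).
Qed.

(** * The map [tau] and the identities for strength and perfection *)

Lemma tau_in_class (A : falg) (C : sigma_quot A) (s : A) :
  FBR A -> in_class C s -> tau C = s^m.
Proof.
  intros [[HS _] Hm] Hs; apply (tau_maximum A HS).
  apply (is_maximum_class A C s _ Hs), Hm.
Qed.

(** Every class has a representative [x], at which [tau] is [x^m], and products of representatives
    represent products of classes. The predicate [P] lets left strength, right strength and
    perfection share this translation. *)
Lemma tau_forall (A : falg) (P : A -> A -> A -> Prop) :
  FBR A ->
  (forall m n : sigma_quot A, P (tau m) (tau n) (tau (quot_mul m n))) <->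
  (forall x y : A, P (x^m) (y^m) ((x * y)^m)).
Proof.
  intro HA; split; intro H.
  - intros x y; specialize (H (class_of x) (class_of y)).
    rewrite (tau_in_class A (class_of x) x HA (sigma_refl x)) in H.
    rewrite (tau_in_class A (class_of y) y HA (sigma_refl y)) in H.
    rewrite (tau_in_class A _ (x * y) HA) in H
      by (apply in_quot_mul; apply sigma_refl).
    exact H.
  - intros C D.
    destruct (class_inhabited A C) as [x Hx], (class_inhabited A D) as [y Hy].
    rewrite (tau_in_class A C x HA Hx), (tau_in_class A D y HA Hy).
    rewrite (tau_in_class A _ (x * y) HA) by (apply in_quot_mul; assumption).
    apply H.
Qed.

Lemma tau_quot_one (A : falg) : FBR A -> tau (quot_one A) = 1.
Proof.
  intro HA; rewrite (tau_in_class A _ 1 HA) by apply sigma_refl.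
  apply FBRP in HA as (HS & Hmul & _).
  rewrite <- (Hmul 1) at 2.
  now rewrite (star1 A HS), (br_mulx1 HS).
Qed.

Lemma left_strongP (A : falg) :
  FBR A -> (left_strong A <-> satisfies A ls_identity).
Proof.
  intro HA; unfold left_strong.
  rewrite (tau_forall A (fun x y z => x * y = x^+ * z) HA); split.
  - intros H v; apply H.
  - intros H x y; exact (H (valuation x y y)).
Qed.

Lemma right_strongP (A : falg) :
  FBR A -> (right_strong A <-> satisfies A rs_identity).
Proof.
  intro HA; unfold right_strong.
  rewrite (tau_forall A (fun x y z => x * y = z * y^*) HA); split.
  - intros H v; apply H.
  - intros H x y; exact (H (valuation x y y)).
Qed.

Lemma perfectP (A : falg) :
  FBR A -> (perfect A <-> satisfies A perfect_identity).
Proof.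
  intro HA; unfold perfect.
  rewrite (tau_forall A (fun x y z => z = x * y) HA); split.
  - intros [H _] v; symmetry; apply H.
  - intro H; split; [|now apply tau_quot_one].
    intros x y; symmetry; exact (H (valuation x y y)).
Qed.

Lemma FBR_ls_defined_by : defined_by FBR_ls (FBR_identities ++ [ls_identity]).
Proof.
  apply defined_by_extend with (1 := FBR_defined_by); intro A.
  rewrite Forall_cons_iff; unfold FBR_ls.
  pose proof (left_strongP A); pose proof (Forall_nil (satisfies A)); tauto.
Qed.

Lemma FBR_rs_defined_by : defined_by FBR_rs (FBR_identities ++ [rs_identity]).
Proof.
  apply defined_by_extend with (1 := FBR_defined_by); intro A.
  rewrite Forall_cons_iff; unfold FBR_rs.
  pose proof (right_strongP A); pose proof (Forall_nil (satisfies A)); tauto.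
Qed.

Lemma FBR_s_defined_by :
  defined_by FBR_s (FBR_identities ++ [ls_identity; rs_identity]).
Proof.
  apply defined_by_extend with (1 := FBR_defined_by); intro A.
  rewrite !Forall_cons_iff; unfold FBR_s, strong.
  pose proof (left_strongP A); pose proof (right_strongP A).
  pose proof (Forall_nil (satisfies A)); tauto.
Qed.

Lemma FBR_p_defined_by :
  defined_by FBR_p (FBR_identities ++ [perfect_identity]).
Proof.
  apply defined_by_extend with (1 := FBR_defined_by); intro A.
  rewrite Forall_cons_iff; unfold FBR_p.
  pose proof (perfectP A); pose proof (Forall_nil (satisfies A)); tauto.
Qed.

Theorem proposition6p2 :
  (is_variety FBR /\ defined_by FBR FBR_identities)
  /\
  ((is_subvariety FBR_ls FBR /\
    defined_by FBR_ls (FBR_identities ++ [ls_identity])) /\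
   (is_subvariety FBR_rs FBR /\
    defined_by FBR_rs (FBR_identities ++ [rs_identity])))
  /\
  (is_subvariety FBR_s FBR /\
   forall A : falg, FBR_s A <-> FBR_ls A /\ FBR_rs A)
  /\
  (is_subvariety FBR_p FBR /\
   defined_by FBR_p (FBR_identities ++ [perfect_identity])).
Proof.
  pose proof FBR_defined_by as H.
  split; [|split; [|split]].
  - split; [exact (defined_by_variety _ _ H) | exact H].
  - split; split.
    + exact (defined_by_subvariety _ _ _ _ H FBR_ls_defined_by).
    + exact FBR_ls_defined_by.
    + exact (defined_by_subvariety _ _ _ _ H FBR_rs_defined_by).
    + exact FBR_rs_defined_by.
  - split; [exact (defined_by_subvariety _ _ _ _ H FBR_s_defined_by)|].
    intro A; unfold FBR_s, FBR_ls, FBR_rs, strong; tauto.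
  - split; [exact (defined_by_subvariety _ _ _ _ H FBR_p_defined_by)|].
    exact FBR_p_defined_by.
Qed.
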